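(* $\{h_k:k\geq2\}^\perp\cap\mathcal{D}_{\delta_1}=\{0\}$, where $\perp$ denotes the orthogonal complement in $H^2$. In particular, the only function holomorphic on a neighborhood of the closed unit disk $\overline{\mathbb{D}}$ that is orthogonal in $H^2$ to every $h_k$, $k\ge2$, is the zero function.
   Context: $H^2$ is the Hardy space on the open unit disk $\mathbb{D}$, $dA$ normalized area measure. For $k\geq 2$, $h_k(z)=\frac{1}{1-z}\big(\mathrm{Log}(1-z^k)-\mathrm{Log}(1-z)-\ln k\big)$ with $\mathrm{Log}$ the principal branch. The local Dirichlet space at $1$, $\mathcal{D}_{\delta_1}$, is the set of $f\in H^2$ with $\int_{\mathbb{D}}|f'(z)|^2\frac{1-|z|^2}{|z-1|^2}\,dA(z)<\infty$; equivalently, $f=c+(z-1)g$ for some $c\in\mathbb{C}$ and $g\in H^2$. *)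

(* Defs.v *)
From Stdlib Require Import Reals Lra.
Open Scope R_scope.

Record Cx : Type := mkC { re : R; im : R }.

Definition C0 : Cx := mkC 0 0.
Definition C1 : Cx := mkC 1 0.
Definition RtoC (x : R) : Cx := mkC x 0.
Definition Cadd (z w : Cx) : Cx := mkC (re z + re w) (im z + im w).
Definition Copp (z : Cx) : Cx := mkC (- re z) (- im z).
Definition Csub (z w : Cx) : Cx := Cadd z (Copp w).
Definition Cmul (z w : Cx) : Cx :=
  mkC (re z * re w - im z * im w) (re z * im w + im z * re w).
Definition Cconj (z : Cx) : Cx := mkC (re z) (- im z).
Definition Cmod (z : Cx) : R := sqrt (re z ^ 2 + im z ^ 2).
Definition Cinv (z : Cx) : Cx :=
  mkC (re z / (re z ^ 2 + im z ^ 2)) (- im z / (re z ^ 2 + im z ^ 2)).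
Definition Cdiv (z w : Cx) : Cx := Cmul z (Cinv w).
Fixpoint Cpow (z : Cx) (n : nat) : Cx :=
  match n with O => C1 | S m => Cmul z (Cpow z m) end.

(* principal argument, with values in (-PI, PI]  (Arg 0 := 0, irrelevant) *)
Definition Arg (z : Cx) : R :=
  let x := re z in let y := im z in
  match Rlt_dec 0 x with
  | left _ => atan (y / x)
  | right _ =>
    match Rlt_dec x 0 with
    | left _ => match Rle_dec 0 y with
                | left _ => atan (y / x) + PI
                | right _ => atan (y / x) - PI
                end
    | right _ => match Rlt_dec 0 y with
                 | left _ => PI / 2
                 | right _ => match Rlt_dec y 0 with
                              | left _ => - (PI / 2)
                              | right _ => 0
                              end
                 end
    end
  end.

Definition CLog (z : Cx) : Cx := mkC (ln (Cmod z)) (Arg z).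

Definition inD (z : Cx) : Prop := Cmod z < 1.

Definition Csum_to (u : nat -> Cx) (l : Cx) : Prop :=
  Un_cv (fun N => sum_f_R0 (fun n => re (u n)) N) (re l) /\
  Un_cv (fun N => sum_f_R0 (fun n => im (u n)) N) (im l).

Definition l2 (a : nat -> Cx) : Prop :=
  exists s : R, infinite_sum (fun n => Cmod (a n) ^ 2) s.

Definition taylor_on_D (a : nat -> Cx) (f : Cx -> Cx) : Prop :=
  forall z, inD z -> Csum_to (fun n => Cmul (a n) (Cpow z n)) (f z).

(* Hardy space H^2: functions on D given by a power series with
   square-summable coefficients (only values on D matter). *)
Definition in_H2 (f : Cx -> Cx) : Prop :=
  exists a, l2 a /\ taylor_on_D a f.

(* H^2 inner product  <f,g> = sum_n a_n conj(b_n)  (coefficients are unique) *)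
Definition H2_inner (f g : Cx -> Cx) (v : Cx) : Prop :=
  exists a b, l2 a /\ l2 b /\ taylor_on_D a f /\ taylor_on_D b g /\
    Csum_to (fun n => Cmul (a n) (Cconj (b n))) v.

Definition H2_orth (f g : Cx -> Cx) : Prop := H2_inner f g C0.

Definition in_D_delta1 (f : Cx -> Cx) : Prop :=
  exists (c : Cx) (g : Cx -> Cx), in_H2 g /\
    forall z, inD z -> f z = Cadd c (Cmul (Csub z C1) (g z)).

Definition h (k : nat) (z : Cx) : Cx :=
  Cdiv (Csub (Csub (CLog (Csub C1 (Cpow z k))) (CLog (Csub C1 z)))
             (RtoC (ln (INR k))))
       (Csub C1 z).

Definition Cderivable_at (f : Cx -> Cx) (z : Cx) : Prop :=
  exists l : Cx, forall eps, eps > 0 -> exists delta, delta > 0 /\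
    forall w, 0 < Cmod w < delta ->
      Cmod (Csub (Cdiv (Csub (f (Cadd z w)) (f z)) w) l) < eps.

Definition Copen (U : Cx -> Prop) : Prop :=
  forall z, U z -> exists e, e > 0 /\ forall w, Cmod (Csub w z) < e -> U w.

Definition holo_near_closed_disk (f : Cx -> Cx) : Prop :=
  exists U : Cx -> Prop, Copen U /\ (forall z, Cmod z <= 1 -> U z) /\
    forall z, U z -> Cderivable_at f z.

(* Main.v *)
(* On the real axis the Taylor coefficients of [h k] are seen to be
    [H_m - H_(m/k) - ln k] ([H_m] the harmonic numbers).  If
    [f = c + (z - 1) g], Abel summation turns the orthogonality of [f] and
    [h k] into [S 1 - S k = c ln k], where [S k] is the sum over [j >= 1] of
    [G (k j) / j] and [G n] is the coefficient of [z^(n-1)] in [g].  As [G] is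
    square-summable, [S k] tends to [0], whence [c = 0] and [S k = 0] for all
    [k].  Sieving by the primes up to [y] leaves, for every [n], the vanishing
    of the sum of [G (n m) / m] over the [m] without divisors in [2 .. y];
    as [y] tends to infinity only the term [m = 1] survives, so [G n = 0].

    A function holomorphic near the closed disk is of the form [c + (z - 1) g]
    with [g] in [H^2]: differentiability at [1] bounds [g] near [1], elsewhere
    [g] is dominated by [f - c], and Parseval's identity at the roots of unity
    on each circle of radius [r < 1] bounds the coefficients of [g]. *)

From Coquelicot Require Import Rcomplements Rbar Hierarchy Lim_seq Series PSeries Derive.
From Stdlib Require Import Reals Lra Lia Arith.
Require Import Defs.
Open Scope R_scope.

(** * Series over multiples *)

Lemma is_series_partial_sums (u : nat -> R) (l : R) :
  is_series u l <-> is_lim_seq (sum_f_R0 u) l.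
Proof. rewrite is_series_Reals, is_lim_seq_Reals. reflexivity. Qed.

Lemma ex_series_leR (u v : nat -> R) :
  (forall n, Rabs (u n) <= v n) -> ex_series v -> ex_series u.
Proof. intros H Hv. exact (ex_series_le u v H Hv). Qed.

Lemma ex_series_bounded (u : nat -> R) (B : R) :
  (forall n, 0 <= u n) -> (forall N, sum_f_R0 u N <= B) -> ex_series u.
Proof.
  intros Hu HB.
  destruct (ex_finite_lim_seq_incr (sum_f_R0 u) B) as [l Hl].
  - intros n. simpl. specialize (Hu (S n)). lra.
  - exact HB.
  - exists l. now apply is_series_partial_sums.
Qed.

Lemma Series_ge0 (u : nat -> R) :
  (forall n, 0 <= u n) -> ex_series u -> 0 <= Series u.
Proof.
  intros Hu H. rewrite <- (Rmult_0_l (Series (fun _ : nat => 0))), <- Series_scal_l.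
  apply Series_le; trivial. intros n. specialize (Hu n). lra.
Qed.

Lemma Rabs_pow_lt_1 (x : R) (k : nat) : (1 <= k)%nat -> Rabs x < 1 -> Rabs (x ^ k) < 1.
Proof.
  intros Hk Hx. rewrite <- RPow_abs. destruct k as [|k]; [lia|].
  simpl. assert (P := Rabs_pos x).
  assert (Rabs x ^ k <= 1 ^ k) by (apply pow_incr; lra). rewrite pow1 in *.
  assert (0 <= Rabs x ^ k) by now apply pow_le. nra.
Qed.

(** The case [n = 0] rests on [/ 0 = 0]. The same convention makes the index 0 harmless in every
    series weighted by [/ INR n]. *)
Lemma Rabs_inv_INR_le_1 (n : nat) : Rabs (/ INR n) <= 1.
Proof.
  destruct n as [|n]; [simpl; rewrite Rinv_0, Rabs_R0; lra|].
  assert (1 <= INR (S n)) by (apply (le_INR 1); lia).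
  rewrite Rabs_right; [|apply Rle_ge, Rlt_le, Rinv_0_lt_compat; lra].
  rewrite <- Rinv_1. apply Rinv_le_contravar; lra.
Qed.

Lemma ex_series_inv_sqr : ex_series (fun n => (/ INR n) ^ 2).
Proof.
  apply ex_series_bounded with 2; [intros; apply pow2_ge_0|].
  (* Telescoping: [/ (x + 1) ^ 2] is at most [/ x - / (x + 1)]. *)
  assert (H : forall N, sum_f_R0 (fun n => (/ INR n) ^ 2) (S N) <= 2 - / INR (S N)).
  { induction N.
    - simpl. rewrite Rinv_0, Rinv_1. lra.
    - remember (S N) as M. rewrite tech5.
      apply Rle_trans with (1 := Rplus_le_compat_r _ _ _ IHN).
      assert (HM : 1 <= INR M) by (apply (le_INR 1); lia).
      rewrite S_INR. set (x := INR M) in *.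
      assert (E : 2 - / x + (/ (x + 1)) ^ 2
                  = 2 - / (x + 1) - / (x * (x + 1) ^ 2)) by (field; lra).
      assert (0 < / (x * (x + 1) ^ 2)) by (apply Rinv_0_lt_compat; nra).
      lra. }
  intros [|N].
  - simpl. rewrite Rinv_0. lra.
  - assert (0 < / INR (S N)) by (apply Rinv_0_lt_compat, (lt_INR 0); lia).
    specialize (H N). lra.
Qed.

Lemma ex_series_prod (u v : nat -> R) :
  ex_series (fun n => u n ^ 2) -> ex_series (fun n => v n ^ 2) ->
  ex_series (fun n => u n * v n).
Proof.
  intros Hu Hv.
  apply ex_series_leR with (fun n => u n ^ 2 + v n ^ 2).
  - intros n. apply Rabs_le. nra.
  - exact (ex_series_plus _ _ Hu Hv).
Qed.

(** A form of the Cauchy-Schwarz inequality. As [eta] is chosen before [u] and [v], it serves a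
    whole family of dilated or sieved sequences at once. *)
Lemma Series_prod_small (B eps : R) :
  0 <= B -> 0 < eps ->
  exists eta, 0 < eta /\ forall u v : nat -> R,
    ex_series (fun n => u n ^ 2) -> ex_series (fun n => v n ^ 2) ->
    Series (fun n => u n ^ 2) <= eta -> Series (fun n => v n ^ 2) <= B ->
    Rabs (Series (fun n => u n * v n)) <= eps.
Proof.
  intros HB He.
  (* With this weight each of the two squares contributes at most [eps / 2]; [B + 1] in place of [B]
     keeps it positive. *)
  set (lam := (B + 1) / eps).
  assert (Hl : 0 < lam) by (apply Rdiv_lt_0_compat; lra).
  exists (eps / lam). split; [now apply Rdiv_lt_0_compat|].
  intros u v Hu Hv Su Sv.
  set (w := fun n => lam / 2 * u n ^ 2 + / (2 * lam) * v n ^ 2).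
  assert (Hw : ex_series w).
  { apply (ex_series_plus (fun n => lam / 2 * u n ^ 2) (fun n => / (2 * lam) * v n ^ 2)).
    - now apply (ex_series_scal_l (lam / 2) (fun n => u n ^ 2)).
    - now apply (ex_series_scal_l (/ (2 * lam)) (fun n => v n ^ 2)). }
  assert (H : forall n, 0 <= Rabs (u n * v n) <= w n).
  { intros n. split; [apply Rabs_pos|]. unfold w.
    (* AM-GM with weight [lam] *)
    assert (E1 : lam / 2 * u n ^ 2 + / (2 * lam) * v n ^ 2 - u n * v n
      = / (2 * lam) * (lam * u n - v n) ^ 2) by (field; lra).
    assert (E2 : lam / 2 * u n ^ 2 + / (2 * lam) * v n ^ 2 + u n * v n
      = / (2 * lam) * (lam * u n + v n) ^ 2) by (field; lra).
    assert (Hi : 0 < / (2 * lam)) by (apply Rinv_0_lt_compat; lra).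
    assert (P1 := Rmult_le_pos _ _ (Rlt_le _ _ Hi) (pow2_ge_0 (lam * u n - v n))).
    assert (P2 := Rmult_le_pos _ _ (Rlt_le _ _ Hi) (pow2_ge_0 (lam * u n + v n))).
    apply Rabs_le. lra. }
  apply Rle_trans with (Series (fun n => Rabs (u n * v n))).
  { apply Series_Rabs. apply ex_series_leR with w; [|exact Hw].
    intros n. rewrite Rabs_Rabsolu. apply H. }
  apply Rle_trans with (Series w).
  { now apply Series_le. }
  unfold w. rewrite Series_plus.
  2: now apply (ex_series_scal_l (lam / 2) (fun n => u n ^ 2)).
  2: now apply (ex_series_scal_l (/ (2 * lam)) (fun n => v n ^ 2)).
  rewrite 2!Series_scal_l.
  assert (H1 : lam / 2 * Series (fun n => u n ^ 2) <= lam / 2 * (eps / lam))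
    by (apply Rmult_le_compat_l; lra).
  assert (H2 : / (2 * lam) * Series (fun n => v n ^ 2) <= / (2 * lam) * (B + 1)).
  { apply Rmult_le_compat_l; [|lra].
    apply Rlt_le, Rinv_0_lt_compat; lra. }
  replace (lam / 2 * (eps / lam)) with (eps / 2) in H1 by (field; lra).
  replace (/ (2 * lam) * (B + 1)) with (eps / 2) in H2
    by (unfold lam; field; lra).
  lra.
Qed.

(** [K] depends on [u] alone: [v] stands for the terms at multiples of [k], or for the weights left
    by the sieve. *)
Lemma Series_tail_small (u : nat -> R) (eps : R) :
  (forall n, 0 <= u n) -> ex_series u -> 0 < eps ->
  exists K, forall k (v : nat -> R), (K <= k)%nat ->
    (forall n, 0 <= v n <= u n) -> (forall n, (n < k)%nat -> v n = 0) ->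
    Series v <= eps.
Proof.
  intros Hu Hex He.
  assert (HU : Un_cv (sum_f_R0 u) (Series u)).
  { apply is_lim_seq_Reals, is_series_partial_sums, Series_correct, Hex. }
  destruct (HU eps He) as [K HK].
  (* The partial sum up to [K] contains the index [K], where [v] has to vanish as well. *)
  exists (S K). intros k v Hk Hv H0.
  assert (Hexv : ex_series v).
  { apply ex_series_leR with u; [|exact Hex].
    intros n. rewrite Rabs_right; [apply Hv|apply Rle_ge, Hv]. }
  rewrite (Series_incr_n v (S K)); [|lia|exact Hexv].
  assert (E := Series_incr_n u (S K) ltac:(lia) Hex). simpl pred in *.
  rewrite (sum_eq_R0 v K); [|intros n Hn; apply H0; lia].
  assert (L : Series (fun n => v (S K + n)%nat) <= Series (fun n => u (S K + n)%nat)).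
  { apply Series_le; [intros n; apply Hv|].
    now apply (ex_series_incr_n u (S K)). }
  specialize (HK K (le_n K)). unfold Rdist in HK. apply Rabs_def2 in HK. lra.
Qed.

Definition dvdb (k n : nat) : bool := Nat.eqb (n mod k) 0.

Lemma dvdbP (k n : nat) : k <> 0%nat -> dvdb k n = true <-> Nat.divide k n.
Proof.
  intros Hk. unfold dvdb. rewrite Nat.eqb_eq. now apply Nat.Lcm0.mod_divide.
Qed.

Lemma dvdb_mul (k j : nat) : dvdb k (k * j) = true.
Proof. unfold dvdb. now rewrite Nat.mul_comm, Nat.Div0.mod_mul. Qed.

Lemma sum_multiples (F : nat -> R) (k N : nat) : (1 <= k)%nat ->
  sum_f_R0 (fun n => if dvdb k n then F n else 0) (k * N)
  = sum_f_R0 (fun j => F (k * j)%nat) N.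
Proof.
  intros Hk. induction N as [|N IH].
  - rewrite Nat.mul_0_r. simpl. unfold dvdb. rewrite Nat.Div0.mod_0_l.
    now rewrite Nat.mul_0_r.
  (* No multiple of [k] lies strictly between [k * N] and [k * N + k], so the filtered sum is
     constant there. *)
  - assert (H : forall i, (i < k)%nat ->
      sum_f_R0 (fun n => if dvdb k n then F n else 0) (k * N + i)
      = sum_f_R0 (fun n => if dvdb k n then F n else 0) (k * N)).
    { induction i as [|i IHi]; intros Hi; [now rewrite Nat.add_0_r|].
      rewrite Nat.add_succ_r. simpl. rewrite IHi by lia.
      unfold dvdb at 2.
      replace (S (k * N + i))%nat with (S i + N * k)%nat by lia.
      rewrite Nat.Div0.mod_add, Nat.mod_small by lia. simpl. lra. }
    replace (k * S N)%nat with (S (k * N + (k - 1)))%nat by lia.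
    simpl. rewrite H by lia. rewrite IH.
    replace (S (k * N + (k - 1)))%nat with (k * S N)%nat by lia.
    now rewrite dvdb_mul.
Qed.

(** The partial sums of the dilated series form a subsequence of those of the filtered one, so
    convergence passes in this direction. *)
Lemma is_series_multiples (F : nat -> R) (k : nat) (l : R) : (1 <= k)%nat ->
  is_series (fun n => if dvdb k n then F n else 0) l ->
  is_series (fun j => F (k * j)%nat) l.
Proof.
  intros Hk. rewrite 2!is_series_partial_sums. intros H.
  apply (is_lim_seq_ext
    (fun N => sum_f_R0 (fun n => if dvdb k n then F n else 0) (k * N))).
  - intros N. now apply sum_multiples.
  - apply is_lim_seq_subseq with (2 := H).
    intros P [N0 HN0]. exists N0. intros n Hn. apply HN0. nia.
Qed.

Lemma ex_series_multiples (F : nat -> R) (k : nat) : (1 <= k)%nat ->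
  ex_series (fun n => if dvdb k n then F n else 0) ->
  ex_series (fun j => F (k * j)%nat).
Proof. intros Hk [l Hl]. exists l. now apply is_series_multiples. Qed.

Lemma Series_multiples (F : nat -> R) (k : nat) : (1 <= k)%nat ->
  ex_series (fun n => if dvdb k n then F n else 0) ->
  Series (fun n => if dvdb k n then F n else 0) = Series (fun j => F (k * j)%nat).
Proof.
  intros Hk H. symmetry. apply is_series_unique, is_series_multiples; trivial.
  now apply Series_correct.
Qed.

Lemma ex_series_if (c : nat -> bool) (u : nat -> R) : (forall n, 0 <= u n) ->
  ex_series u -> ex_series (fun n => if c n then u n else 0).
Proof.
  intros Hu. apply ex_series_leR. intros n. specialize (Hu n).
  destruct (c n); [rewrite Rabs_right; lra|rewrite Rabs_R0; lra].
Qed.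

Lemma ex_series_sqr_multiples (G : nat -> R) (k : nat) : (1 <= k)%nat ->
  ex_series (fun n => G n ^ 2) -> ex_series (fun j => G (k * j)%nat ^ 2).
Proof.
  intros Hk H. apply (ex_series_multiples (fun n => G n ^ 2)); trivial.
  apply (ex_series_if (dvdb k)); trivial. intros n. apply pow2_ge_0.
Qed.

(** Nonzero multiples of [k] are at least [k], so the sum is part of a tail; [G 0 = 0] takes care of
    the multiple 0. *)
Lemma Series_sqr_multiples_small (G : nat -> R) (eps : R) :
  G 0%nat = 0 -> ex_series (fun n => G n ^ 2) -> 0 < eps ->
  exists K, forall k, (K <= k)%nat -> Series (fun j => G (k * j)%nat ^ 2) <= eps.
Proof.
  intros G0 H He.
  destruct (Series_tail_small (fun n => G n ^ 2) eps) as [K HK]; trivial.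
  { intros n. apply pow2_ge_0. }
  exists (S K). intros k Hk.
  rewrite <- (Series_multiples (fun n => G n ^ 2) k ltac:(lia)).
  - apply (HK k); [lia| |].
    + intros n. assert (P := pow2_ge_0 (G n)). destruct (dvdb k n); lra.
    + intros [|n] Hn.
      * unfold dvdb. rewrite Nat.Div0.mod_0_l, G0. simpl. ring.
      * unfold dvdb. now rewrite Nat.mod_small by lia.
  - apply (ex_series_if (dvdb k)); trivial. intros n. apply pow2_ge_0.
Qed.

(** * Sieving *)

(** The tested divisors are [2 .. y + 1], so that [y + 2] is the next number to sieve by and
    [rough 0] excludes nothing. *)
Fixpoint rough (y m : nat) : bool :=
  match y with
  | O => true
  | S y' => andb (rough y' m) (negb (dvdb (S (S y')) m))
  end.

Lemma roughP (y m : nat) :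
  rough y m = true <-> forall d, (2 <= d <= S y)%nat -> ~ Nat.divide d m.
Proof.
  induction y as [|y IH]; simpl.
  - split; [intros _ d Hd; lia|trivial].
  - rewrite Bool.andb_true_iff, IH, Bool.negb_true_iff, <- Bool.not_true_iff_false,
      dvdbP by lia.
    split.
    + intros [H1 H2] d Hd.
      destruct (Nat.eq_dec d (S (S y))) as [->|]; [exact H2|apply H1; lia].
    + intros H. split; [intros d Hd|]; apply H; lia.
Qed.

(* A rough [y + 2] is prime, so it is coprime to every [d <= y + 1]. *)
Lemma rough_prime_mul (y j : nat) : rough y (S (S y)) = true ->
  rough y (S (S y) * j) = rough y j.
Proof.
  intros Hp. apply Bool.eq_iff_eq_true. rewrite roughP in Hp. rewrite 2!roughP.
  split; intros H d Hd Hdiv; apply (H d Hd).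
  - apply Nat.divide_trans with (1 := Hdiv). apply Nat.divide_factor_r.
  - apply Nat.gauss with (S (S y)); trivial.
    destruct (Nat.gcd_divide d (S (S y))) as [D1 D2].
    assert (Hg : (Nat.gcd d (S (S y)) <= d)%nat) by (apply Nat.divide_pos_le; [lia|trivial]).
    destruct (Nat.eq_dec (Nat.gcd d (S (S y))) 0) as [E|E].
    { apply Nat.gcd_eq_0_l in E. lia. }
    destruct (Nat.eq_dec (Nat.gcd d (S (S y))) 1) as [E1|E1]; trivial.
    exfalso. apply (Hp (Nat.gcd d (S (S y)))); [lia|trivial].
Qed.

(** This is the sieving step at a composite [p]: its multiples are already gone, so nothing
    changes. *)
Lemma rough_mul_false (y p j : nat) : rough y p = false -> rough y (p * j) = false.
Proof.
  intros Hp. apply Bool.not_true_iff_false. intros H.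
  apply Bool.not_true_iff_false in Hp. apply Hp.
  rewrite roughP in *. intros d Hd Hdiv. apply (H d Hd).
  apply Nat.divide_trans with (1 := Hdiv). apply Nat.divide_factor_l.
Qed.

Definition rough_inv (y m : nat) : R := if rough y m then / INR m else 0.

Lemma rough_inv_sqr_le (y m : nat) : 0 <= rough_inv y m ^ 2 <= (/ INR m) ^ 2.
Proof.
  unfold rough_inv. assert (P := pow2_ge_0 (/ INR m)). destruct (rough y m); lra.
Qed.

Lemma ex_series_rough_inv_sqr (y : nat) : ex_series (fun m => rough_inv y m ^ 2).
Proof.
  apply ex_series_leR with (2 := ex_series_inv_sqr). intros m.
  assert (P := rough_inv_sqr_le y m). rewrite Rabs_right; lra.
Qed.

(** Passing from [y] to [y + 1] removes the terms at multiples of [p = y + 2]. They add up to 0, by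
    the induction hypothesis at [n * p] when [p] is prime; hence the induction is for all [n]
    together. *)
Lemma sieve (G : nat -> R) : ex_series (fun n => G n ^ 2) ->
  (forall n, (1 <= n)%nat -> Series (fun m => / INR m * G (n * m)%nat) = 0) ->
  forall y n, (1 <= n)%nat -> Series (fun m => rough_inv y m * G (n * m)%nat) = 0.
Proof.
  intros HG H0 y. induction y as [|y IH]; intros n Hn; [exact (H0 n Hn)|].
  set (F := fun m => rough_inv y m * G (n * m)%nat).
  assert (HF : forall y, ex_series (fun m => rough_inv y m * G (n * m)%nat)).
  { intros y'. apply ex_series_prod; [apply ex_series_rough_inv_sqr|].
    now apply ex_series_sqr_multiples. }
  set (p := S (S y)).
  assert (E : forall m, rough_inv (S y) m * G (n * m)%nat
                        = F m - (if dvdb p m then F m else 0)).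
  { intros m. unfold F, rough_inv. simpl rough. fold p.
    destruct (rough y m), (dvdb p m); simpl; ring. }
  (* The removed part is the difference of two convergent series. *)
  assert (Hm : ex_series (fun m => if dvdb p m then F m else 0)).
  { apply (ex_series_ext (fun m => F m - rough_inv (S y) m * G (n * m)%nat)).
    - intros m. rewrite E. change (F m - (F m - (if dvdb p m then F m else 0))
        = if dvdb p m then F m else 0). ring.
    - exact (ex_series_minus _ _ (HF y) (HF (S y))). }
  rewrite (Series_ext _ _ E), Series_minus; [|apply HF|exact Hm].
  unfold F at 1. rewrite (IH n Hn).
  rewrite Series_multiples; [|unfold p; lia|exact Hm].
  assert (Z : Series (fun j => F (p * j)%nat) = 0); [|rewrite Z; ring].
  (* For [p] prime the removed part is [/ INR p] times the sieved series at [n * p]; otherwise each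
     of its terms is 0. *)
  destruct (rough y p) eqn:Hp.
  - rewrite (Series_ext _ (fun j => / INR p * (rough_inv y j * G (n * p * j)%nat))).
    + rewrite Series_scal_l, IH by (unfold p; nia). ring.
    + intros j. unfold F, rough_inv, p. rewrite rough_prime_mul by trivial.
      destruct (rough y j); [|ring].
      rewrite mult_INR, Rinv_mult, Nat.mul_assoc. ring.
  - rewrite (Series_ext _ (fun j => 0 * 0)).
    + rewrite (Series_scal_l 0). ring.
    + intros j. unfold F, rough_inv. rewrite rough_mul_false by trivial. ring.
Qed.

(** In the sieved series [m = 1] contributes [G n], the terms [m = 2 .. y + 1] vanish, and the rest
    is small because its weights come from a tail of the sum of [/ m ^ 2]. *)
Lemma dilation_series_eq0 (G : nat -> R) : ex_series (fun n => G n ^ 2) ->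
  (forall n, (1 <= n)%nat -> Series (fun m => / INR m * G (n * m)%nat) = 0) ->
  forall n, (1 <= n)%nat -> G n = 0.
Proof.
  intros HG H0 n Hn.
  assert (HGn : ex_series (fun k => G (n * (2 + k))%nat ^ 2)).
  { apply (ex_series_incr_n (fun m => G (n * m)%nat ^ 2) 2).
    now apply ex_series_sqr_multiples. }
  assert (HB : 0 <= Series (fun k => G (n * (2 + k))%nat ^ 2)).
  { apply Series_ge0; trivial. intros k. apply pow2_ge_0. }
  apply cond_eq. intros eps He. rewrite Rminus_0_r.
  destruct (Series_prod_small _ (eps / 2) HB ltac:(lra)) as [eta [Heta Hsm]].
  destruct (Series_tail_small (fun k => (/ INR (2 + k)) ^ 2) eta) as [y Hy]; trivial.
  { intros k. apply pow2_ge_0. }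
  { apply (ex_series_incr_n (fun m => (/ INR m) ^ 2) 2), ex_series_inv_sqr. }
  assert (Hw : ex_series (fun k => rough_inv y (2 + k) ^ 2)).
  { apply (ex_series_incr_n (fun m => rough_inv y m ^ 2) 2), ex_series_rough_inv_sqr. }
  assert (S0 := sieve G HG H0 y n Hn).
  rewrite (Series_incr_n _ 2) in S0; [|lia|].
  2:{ apply ex_series_prod; [apply ex_series_rough_inv_sqr|].
      now apply ex_series_sqr_multiples. }
  (* The term [m = 0] is 0 because [/ INR 0] is, and 1 survives every sieving. *)
  assert (E : sum_f_R0 (fun m => rough_inv y m * G (n * m)%nat) (pred 2) = G n).
  { simpl. rewrite Nat.mul_1_r.
    assert (R1 : rough y 1 = true).
    { apply roughP. intros d Hd Hdiv. apply Nat.divide_1_r in Hdiv. lia. }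
    unfold rough_inv. rewrite R1. simpl. rewrite Rinv_0, Rinv_1.
    destruct (rough y 0); ring. }
  rewrite E in S0.
  replace (G n) with (- Series (fun k => rough_inv y (2 + k) * G (n * (2 + k))%nat)) by lra.
  rewrite Rabs_Ropp. apply Rle_lt_trans with (eps / 2); [|lra].
  apply Hsm; trivial; [|lra].
  apply (Hy y); trivial.
  - intros k. apply rough_inv_sqr_le.
  (* For [k < y] the number [2 + k] is among the sieving divisors and divides itself. *)
  - intros k Hk. unfold rough_inv.
    replace (rough y (2 + k)) with false; [simpl; ring|].
    symmetry. apply Bool.not_true_iff_false. rewrite roughP. intros H.
    apply (H (2 + k)%nat); [lia|apply Nat.divide_refl].
Qed.

(** Here the weights stay fixed and the smallness comes from the square sum of [G] over the
    multiples of [k]. *)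
Lemma dilation_series_lim (G : nat -> R) (eps : R) :
  G 0%nat = 0 -> ex_series (fun n => G n ^ 2) -> 0 < eps ->
  exists K, forall k, (K <= k)%nat ->
    Rabs (Series (fun j => / INR j * G (k * j)%nat)) <= eps.
Proof.
  intros G0 HG He.
  assert (HB : 0 <= Series (fun n => (/ INR n) ^ 2)).
  { apply Series_ge0; [intros k; apply pow2_ge_0|exact ex_series_inv_sqr]. }
  destruct (Series_prod_small _ eps HB He) as [eta [Heta Hsm]].
  destruct (Series_sqr_multiples_small G eta G0 HG Heta) as [K HK].
  exists (S K). intros k Hk.
  rewrite (Series_ext _ (fun j => G (k * j)%nat * / INR j)) by (intros; apply Rmult_comm).
  apply Hsm.
  - apply ex_series_sqr_multiples; [lia|trivial].
  - exact ex_series_inv_sqr.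
  - apply HK. lia.
  - lra.
Qed.

(** * Recovering the constant and the coefficients *)

Lemma dilation_differences_eq0 (G : nat -> R) (c : R) :
  G 0%nat = 0 -> ex_series (fun n => G n ^ 2) ->
  (forall k, (2 <= k)%nat ->
    is_series (fun n => G n * ((1 - (if dvdb k n then INR k else 0)) / INR n))
      (c * ln (INR k))) ->
  c = 0 /\ forall n, G n = 0.
Proof.
  intros G0 HG H.
  set (T := fun k => Series (fun j => / INR j * G (k * j)%nat)).
  set (F := fun n => / INR n * G n).
  assert (HF : ex_series F) by (apply ex_series_prod; trivial; exact ex_series_inv_sqr).
  assert (HT : forall k, (2 <= k)%nat -> Series F - T k = c * ln (INR k)).
  { intros k Hk. specialize (H k Hk).
    assert (Hk0 : INR k <> 0) by (apply not_0_INR; lia).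
    (* Subtracting the hypothesis from the series of [F] isolates the multiples of [k], and
       [INR k * F (k * j)] is [G (k * j) / j]. *)
    assert (HD : is_series (fun n => if dvdb k n then INR k * F n else 0)
                   (Series F - c * ln (INR k))).
    { apply (is_series_ext (fun n => F n
        - G n * ((1 - (if dvdb k n then INR k else 0)) / INR n))).
      - intros n. unfold F.
        match goal with |- ?a = ?b => change (a = b :> R) end.
        destruct (dvdb k n); unfold Rdiv; ring.
      - exact (is_series_minus _ _ _ _ (Series_correct _ HF) H). }
    apply is_series_multiples in HD; [|lia].
    apply is_series_unique in HD.
    replace (T k) with (Series (fun j => INR k * F (k * j)%nat)); [rewrite HD; ring|].
    apply Series_ext. intros j. unfold F. rewrite mult_INR, Rinv_mult.
    transitivity (INR k * / INR k * (/ INR j * G (k * j)%nat)); [ring|].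
    rewrite Rinv_r by trivial. ring. }
  (* Comparing [k] with [2 * k] gives [T k - T (2 * k) = c * ln 2], whose left side is arbitrarily
     small. *)
  assert (Hc : c = 0).
  { assert (Hln2 : 0 < ln 2) by (rewrite <- ln_1; apply ln_increasing; lra).
    apply Rmult_eq_reg_r with (ln 2); [|lra]. rewrite Rmult_0_l.
    apply cond_eq. intros eps He. rewrite Rminus_0_r.
    destruct (dilation_series_lim G (eps / 3) G0 HG ltac:(lra)) as [K HK].
    assert (H1 := HK (2 + K)%nat ltac:(lia)).
    assert (H2 := HK (2 * (2 + K))%nat ltac:(lia)).
    fold (T (2 + K)%nat) in H1. fold (T (2 * (2 + K))%nat) in H2.
    assert (E1 := HT (2 + K)%nat ltac:(lia)).
    assert (E2 := HT (2 * (2 + K))%nat ltac:(lia)).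
    assert (0 < INR (2 + K)) by (apply (lt_INR 0); lia).
    rewrite (mult_INR 2), ln_mult in E2; [|simpl; lra|trivial].
    replace (INR 2) with 2 in E2 by (simpl; lra).
    replace (c * ln 2) with (T (2 + K)%nat - T (2 * (2 + K))%nat) by lra.
    apply Rabs_def1; apply Rabs_le_between in H1, H2; lra. }
  split; trivial.
  (* Now that [c = 0], [Series F] equals every [T k], and these tend to 0. *)
  assert (HS : Series F = 0).
  { apply cond_eq. intros eps He. rewrite Rminus_0_r.
    destruct (dilation_series_lim G (eps / 3) G0 HG ltac:(lra)) as [K HK].
    assert (H1 := HK (2 + K)%nat ltac:(lia)).
    fold (T (2 + K)%nat) in H1.
    assert (E1 := HT (2 + K)%nat ltac:(lia)). rewrite Hc in E1.
    replace (Series F) with (T (2 + K)%nat) by lra. lra. }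
  intros [|n]; trivial.
  apply dilation_series_eq0; trivial; [|lia].
  intros [|[|k]] Hk; [lia| |].
  - rewrite <- HS. apply Series_ext. intros m. now rewrite Nat.mul_1_l.
  - fold (T (S (S k))). assert (E := HT (S (S k)) ltac:(lia)). rewrite Hc in E. lra.
Qed.

(** Abel summation moves the difference from [a] to [b k], whose increments are explicit. Real
    sequences suffice: the coefficients of [h k] are real, so real and imaginary parts of [f]
    separate. *)
Lemma orthogonal_coefficients_eq0 (g a : nat -> R) (c : R) (b : nat -> nat -> R) :
  ex_series (fun n => g n ^ 2) ->
  a 0%nat = c - g 0%nat -> (forall n, a (S n) = g n - g (S n)) ->
  (forall k, (2 <= k)%nat -> b k 0%nat = - ln (INR k)) ->
  (forall k n, (2 <= k)%nat -> b k (S n) - b k n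
     = (1 - (if dvdb k (S n) then INR k else 0)) / INR (S n)) ->
  (forall k, (2 <= k)%nat -> ex_series (fun n => b k n ^ 2)) ->
  (forall k, (2 <= k)%nat -> is_series (fun n => a n * b k n) 0) ->
  forall n, a n = 0.
Proof.
  intros Hg Ha0 HaS Hb0 HbS Hb H.
  (* The shift aligns [g n] with the increment from [b k n] to [b k (S n)], which has denominator
     [S n]. *)
  set (G := fun n => match n with O => 0 | S m => g m end).
  assert (HG : ex_series (fun n => G n ^ 2)).
  { apply ex_series_incr_1. exact Hg. }
  destruct (dilation_differences_eq0 G c) as [Hc HG0]; trivial.
  { intros k Hk. apply is_series_partial_sums.
    assert (P : forall N, sum_f_R0 (fun n => G n * ((1 - (if dvdb k n then INR k else 0)) / INR n)) N
      = sum_f_R0 (fun n => a n * b k n) N + c * ln (INR k) + g N * b k N).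
    { induction N as [|N IH].
      - simpl. rewrite Ha0, Hb0 by trivial. ring.
      - rewrite 2!tech5, IH, HaS. simpl G. rewrite <- HbS by trivial. ring. }
    apply (is_lim_seq_ext _ _ _ (fun N => eq_sym (P N))).
    replace (Finite (c * ln (INR k))) with (Finite (0 + c * ln (INR k) + 0)) by (f_equal; ring).
    apply is_lim_seq_plus'; [apply is_lim_seq_plus'|].
    - apply is_series_partial_sums. now apply H.
    - apply is_lim_seq_const.
    (* The boundary term is a product of two square-summable sequences, hence tends to 0. *)
    - apply ex_series_lim_0, ex_series_prod; trivial. now apply Hb. }
  assert (Hg0 : forall n, g n = 0) by (intros n; apply (HG0 (S n))).
  intros [|n]; [rewrite Ha0|rewrite HaS]; rewrite ?Hg0, ?Hc; ring.
Qed.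

(** * Taylor coefficients of [h k] *)

Lemma CV_radius_ge_bounded (u : nat -> R) (r M : R) :
  (forall n, Rabs (u n * r ^ n) <= M) -> Rbar_le r (CV_radius u).
Proof.
  intros H. destruct (CV_radius_bounded u) as [Hub _]. apply Hub. now exists M.
Qed.

(** Convergence at [1 / 2] bounds the terms there, so the radius is at least [1 / 2]. *)
Lemma CV_radius_pos (u : nat -> R) :
  ex_series (fun n => u n * (1 / 2) ^ n) -> Rbar_lt 0 (CV_radius u).
Proof.
  intros H. apply ex_series_lim_0, is_lim_seq_Reals in H.
  destruct (maj_by_pos _ (exist _ 0 H)) as [M [_ HM]].
  apply Rbar_lt_le_trans with (Finite (1 / 2)); [simpl; lra|].
  exact (CV_radius_ge_bounded u (1 / 2) M HM).
Qed.

Lemma power_series_unique (u v : nat -> R) (s : R -> R) :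
  (forall x, Rabs x < 1 -> is_series (fun n => u n * x ^ n) (s x)) ->
  (forall x, Rabs x < 1 -> is_series (fun n => v n * x ^ n) (s x)) ->
  forall n, u n = v n.
Proof.
  intros Hu Hv n.
  assert (Hh : Rabs (1 / 2) < 1) by (rewrite Rabs_right; lra).
  apply PSeries_ext_recip.
  - apply CV_radius_pos. eexists. now apply Hu.
  - apply CV_radius_pos. eexists. now apply Hv.
  - exists (mkposreal 1 Rlt_0_1). intros x Hx. unfold PSeries.
    assert (Hx1 : Rabs x < 1).
    { unfold ball in Hx; simpl in Hx. unfold AbsRing_ball in Hx.
      unfold minus, plus, opp, abs in Hx; simpl in Hx.
      rewrite Ropp_0, Rplus_0_r in Hx. exact Hx. }
    rewrite (is_series_unique _ _ (Hu x Hx1)). symmetry.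
    apply (is_series_unique _ _ (Hv x Hx1)).
Qed.

(** These are the coefficients of [1 - x] times the power series of [u]. *)
Definition backward_diff (u : nat -> R) (n : nat) : R :=
  match n with O => u O | S m => u (S m) - u m end.

Lemma is_series_backward_diff (u : nat -> R) (x l : R) :
  is_series (fun n => u n * x ^ n) l ->
  is_series (fun n => backward_diff u n * x ^ n) ((1 - x) * l).
Proof.
  intros H.
  assert (H1 : is_series (fun n => PS_incr_1 u n * x ^ n) (x * l)).
  { apply (proj1 (is_pseries_R (PS_incr_1 u) x (x * l))), (is_pseries_incr_1 u x l).
    exact (proj2 (is_pseries_R u x l) H). }
  replace ((1 - x) * l) with (l - x * l) by ring.
  apply (is_series_ext (fun n => u n * x ^ n - PS_incr_1 u n * x ^ n)).
  - intros [|n]; unfold backward_diff, PS_incr_1.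
    + change (u 0%nat * x ^ 0 - 0 * x ^ 0 = u 0%nat * x ^ 0). ring.
    + change (u (S n) * x ^ S n - u n * x ^ S n = (u (S n) - u n) * x ^ S n). ring.
  - exact (is_series_minus _ _ _ _ H H1).
Qed.

Lemma is_series_log (x : R) : Rabs x < 1 ->
  is_series (fun n => / INR n * x ^ n) (- ln (1 - x)).
Proof.
  intros Hx. set (a := fun n => / INR n).
  assert (Hr : forall t, Rabs t < 1 -> Rbar_lt (Rabs t) (CV_radius a)).
  { intros t Ht. apply Rbar_lt_le_trans with (Finite 1); [exact Ht|].
    apply (CV_radius_ge_bounded a 1 1). intros n. rewrite pow1, Rmult_1_r.
    apply Rabs_inv_INR_le_1. }
  assert (HP : is_series (fun n => a n * x ^ n) (PSeries a x)).
  { apply (proj1 (is_pseries_R a x (PSeries a x))), PSeries_correct, CV_radius_inside, Hr, Hx. }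
  replace (- ln (1 - x)) with (PSeries a x); [exact HP|].
  (* The derivative of the series is geometric, so [phi] has derivative 0 on [(-1, 1)]; it vanishes
     at 0. *)
  set (phi := fun t => PSeries a t + ln (1 - t)).
  assert (Hphi : forall t, Rabs t < 1 -> is_derive phi t zero).
  { intros t Ht.
    assert (D1 := is_derive_PSeries a t (Hr t Ht)).
    assert (E : PSeries (PS_derive a) t = / (1 - t)).
    { rewrite <- (Series_geom t Ht). apply Series_ext. intros n.
      unfold PS_derive, a. rewrite Rinv_r; [ring|apply not_0_INR; lia]. }
    rewrite E in D1. apply Rabs_def2 in Ht.
    assert (D2 : is_derive (fun t => ln (1 - t)) t (- / (1 - t))).
    { replace (- / (1 - t)) with (scal (-1) (/ (1 - t))).
      - apply (is_derive_comp ln (fun t => 1 - t)).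
        + apply is_derive_Reals, derivable_pt_lim_ln. lra.
        + apply is_derive_Reals.
          replace (-1) with (0 - 1) by ring.
          apply (derivable_pt_lim_minus (fct_cte 1) id).
          * apply derivable_pt_lim_const.
          * apply derivable_pt_lim_id.
      - change (-1 * / (1 - t) = - / (1 - t)). ring. }
    replace (@zero R_NormedModule) with (plus (/ (1 - t)) (- / (1 - t))).
    - exact (is_derive_plus _ _ _ _ _ D1 D2).
    - change (/ (1 - t) + - / (1 - t) = 0). ring. }
  assert (phi0 : phi 0 = 0).
  { unfold phi. rewrite PSeries_0, Rminus_0_r, ln_1. unfold a. simpl.
    rewrite Rinv_0. ring. }
  apply Rabs_def2 in Hx.
  assert (phix : phi x = 0).
  { destruct (Rtotal_order x 0) as [Hlt|[->|Hgt]]; trivial.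
    - rewrite <- phi0. apply (eq_is_derive phi x 0); trivial.
      intros t Ht. apply Hphi, Rabs_def1; lra.
    - rewrite <- phi0. symmetry. apply (eq_is_derive phi 0 x); trivial.
      intros t Ht. apply Hphi, Rabs_def1; lra. }
  unfold phi in phix. lra.
Qed.

(** The increment at [n] of [H_n - H_(n/k)]: when [k] divides [n], the second harmonic number grows
    by [k / n]. *)
Definition hincr (k n : nat) : R := (1 - (if dvdb k n then INR k else 0)) / INR n.

Lemma is_series_log_pow (k : nat) (x : R) : (1 <= k)%nat -> Rabs x < 1 ->
  is_series (fun n => if dvdb k n then INR k / INR n * x ^ n else 0)
    (- ln (1 - x ^ k)).
Proof.
  intros Hk Hx.
  (* Convergence of the filtered series comes first, since only then can its sum be read off the
     logarithm series at [x ^ k]. *)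
  assert (Hex : ex_series (fun n => if dvdb k n then INR k / INR n * x ^ n else 0)).
  { apply ex_series_leR with (fun n => INR k * Rabs x ^ n).
    - intros n. assert (P := pow_le _ n (Rabs_pos x)). assert (P' := pos_INR k).
      destruct (dvdb k n); [|rewrite Rabs_R0; nra].
      unfold Rdiv. rewrite 2!Rabs_mult, <- RPow_abs, (Rabs_right (INR k)) by lra.
      assert (Q := Rabs_inv_INR_le_1 n).
      apply Rmult_le_compat_r; trivial.
      rewrite <- (Rmult_1_r (INR k)) at 2. now apply Rmult_le_compat_l.
    - apply (ex_series_scal_l (INR k) (fun n => Rabs x ^ n)). eexists. apply is_series_geom.
      now rewrite Rabs_Rabsolu. }
  destruct Hex as [l Hl].
  assert (H1 := is_series_multiples (fun n => INR k / INR n * x ^ n) k l Hk Hl).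
  assert (Hxk := Rabs_pow_lt_1 x k Hk Hx).
  assert (H2 := is_series_log (x ^ k) Hxk).
  replace (- ln (1 - x ^ k)) with l; [exact Hl|].
  rewrite <- (is_series_unique _ _ H1), <- (is_series_unique _ _ H2).
  apply Series_ext. intros j. rewrite mult_INR, pow_mult. unfold Rdiv.
  rewrite Rinv_mult.
  assert (INR k <> 0) by (apply not_0_INR; lia).
  transitivity (INR k * / INR k * (/ INR j * (x ^ k) ^ j)); [ring|].
  rewrite Rinv_r by trivial. ring.
Qed.

Fixpoint hcoef (k n : nat) : R :=
  match n with
  | O => - ln (INR k)
  | S m => hcoef k m + hincr k (S m)
  end.

(** Multiplying [h k] by [1 - x] leaves a constant and two logarithms, whose series have the
    increments [hincr] as coefficients. *)
Lemma is_series_backward_diff_hcoef (k : nat) (x : R) : (1 <= k)%nat -> Rabs x < 1 ->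
  is_series (fun n => backward_diff (hcoef k) n * x ^ n)
    (ln (1 - x ^ k) - ln (1 - x) - ln (INR k)).
Proof.
  intros Hk Hx. apply is_series_partial_sums.
  assert (H := is_series_minus _ _ _ _ (is_series_log x Hx) (is_series_log_pow k x Hk Hx)).
  apply is_series_partial_sums in H.
  eapply (is_lim_seq_plus' _ _ _ _ (is_lim_seq_const (- ln (INR k)))) in H.
  replace (ln (1 - x ^ k) - ln (1 - x) - ln (INR k))
    with (- ln (INR k) + minus (- ln (1 - x)) (- ln (1 - x ^ k))).
  2:{ unfold minus, plus, opp; simpl. ring. }
  apply is_lim_seq_ext with (2 := H).
  intros N. unfold minus, plus, opp; simpl. induction N as [|N IH].
  (* Both logarithm series have index-0 term 0, so only the constant [- ln (INR k)] remains. *)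
  - simpl. rewrite Rinv_0. unfold Rdiv. rewrite Rinv_0. destruct (dvdb k 0); ring.
  - rewrite 2!tech5, <- IH. unfold backward_diff. simpl hcoef. unfold hincr, Rdiv.
    destruct (dvdb k (S N)); ring.
Qed.

(** * Restriction to the real axis *)

Lemma Cx_eq (z w : Cx) : re z = re w -> im z = im w -> z = w.
Proof. destruct z, w; simpl; congruence. Qed.

Lemma Cmod_RtoC (x : R) : Cmod (RtoC x) = Rabs x.
Proof.
  unfold Cmod, RtoC; simpl. rewrite <- sqrt_Rsqr_abs. f_equal. unfold Rsqr. ring.
Qed.

Lemma Cpow_RtoC (x : R) (n : nat) : Cpow (RtoC x) n = RtoC (x ^ n).
Proof.
  induction n as [|n IH]; simpl; trivial. rewrite IH.
  apply Cx_eq; simpl; ring.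
Qed.

Lemma CLog_RtoC (x : R) : 0 < x -> CLog (RtoC x) = RtoC (ln x).
Proof.
  intros Hx. unfold CLog. rewrite Cmod_RtoC, Rabs_right by lra.
  apply Cx_eq; trivial. unfold Arg; simpl.
  destruct (Rlt_dec 0 x); [|lra]. unfold Rdiv. now rewrite Rmult_0_l, atan_0.
Qed.

(** On [(-1, 1)] both [1 - x ^ k] and [1 - x] are positive, where the principal logarithm is the
    real one. *)
Lemma h_RtoC (k : nat) (x : R) : (1 <= k)%nat -> Rabs x < 1 ->
  h k (RtoC x) = RtoC ((ln (1 - x ^ k) - ln (1 - x) - ln (INR k)) / (1 - x)).
Proof.
  intros Hk Hx.
  assert (Hxk := Rabs_pow_lt_1 x k Hk Hx).
  assert (E : forall y, Csub C1 (RtoC y) = RtoC (1 - y)) by (intros; apply Cx_eq; simpl; ring).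
  apply Rabs_def2 in Hx, Hxk.
  unfold h. rewrite Cpow_RtoC, 2!E, 2!CLog_RtoC by lra.
  apply Cx_eq; simpl; field; nra.
Qed.

Lemma taylor_RtoC (a : nat -> Cx) (f : Cx -> Cx) (x : R) :
  taylor_on_D a f -> Rabs x < 1 ->
  is_series (fun n => re (a n) * x ^ n) (re (f (RtoC x))) /\
  is_series (fun n => im (a n) * x ^ n) (im (f (RtoC x))).
Proof.
  intros Ha Hx. destruct (Ha (RtoC x)) as [H1 H2].
  { unfold inD. now rewrite Cmod_RtoC. }
  apply is_lim_seq_Reals, is_series_partial_sums in H1, H2.
  split; eapply is_series_ext.
  2: exact H1. 3: exact H2.
  all: intros n; cbv beta; rewrite Cpow_RtoC; simpl;
    match goal with |- ?a = ?b => change (a = b :> R) end; ring.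
Qed.

Lemma taylor_unique (a b : nat -> Cx) (f : Cx -> Cx) :
  taylor_on_D a f -> taylor_on_D b f -> forall n, a n = b n.
Proof.
  intros Ha Hb n. apply Cx_eq.
  - apply (power_series_unique (fun n => re (a n)) (fun n => re (b n))
      (fun x => re (f (RtoC x)))); intros x Hx; now apply taylor_RtoC.
  - apply (power_series_unique (fun n => im (a n)) (fun n => im (b n))
      (fun x => im (f (RtoC x)))); intros x Hx; now apply taylor_RtoC.
Qed.

(** After multiplication by [1 - x] the real parts have equal backward differences, and summing
    these gives the coefficients. The imaginary parts vanish because [h k] is real on the real
    axis. *)
Lemma taylor_h (k : nat) (b : nat -> Cx) : (1 <= k)%nat ->
  taylor_on_D b (h k) -> forall n, b n = RtoC (hcoef k n).
Proof.
  intros Hk Hb.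
  assert (Hre : forall n, backward_diff (fun n => re (b n)) n = backward_diff (hcoef k) n).
  { apply power_series_unique with (fun x => ln (1 - x ^ k) - ln (1 - x) - ln (INR k)).
    - intros x Hx. destruct (taylor_RtoC b (h k) x Hb Hx) as [H _].
      rewrite h_RtoC in H by trivial. simpl in H.
      apply is_series_backward_diff in H.
      replace (ln (1 - x ^ k) - ln (1 - x) - ln (INR k)) with
        ((1 - x) * ((ln (1 - x ^ k) - ln (1 - x) - ln (INR k)) / (1 - x))); [exact H|].
      apply Rabs_def2 in Hx. field. lra.
    - intros x Hx. now apply is_series_backward_diff_hcoef. }
  intros n. apply Cx_eq; simpl.
  - induction n as [|n IH]; [exact (Hre 0%nat)|].
    specialize (Hre (S n)). unfold backward_diff in Hre. lra.
  - apply (power_series_unique (fun n => im (b n)) (fun _ => 0) (fun _ => 0)).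
    + intros x Hx. destruct (taylor_RtoC b (h k) x Hb Hx) as [_ H].
      rewrite h_RtoC in H by trivial. exact H.
    + intros x Hx. apply is_series_partial_sums.
      apply (is_lim_seq_ext (fun _ => 0)); [|apply is_lim_seq_const].
      intros N. symmetry. apply sum_eq_R0. intros; ring.
Qed.

Lemma Cmod_sqr (z : Cx) : Cmod z ^ 2 = re z ^ 2 + im z ^ 2.
Proof. unfold Cmod. rewrite pow2_sqrt; nra. Qed.

Lemma l2_re_im (a : nat -> Cx) :
  l2 a <-> ex_series (fun n => re (a n) ^ 2) /\ ex_series (fun n => im (a n) ^ 2).
Proof.
  split.
  - intros [s Hs]. apply is_series_Reals in Hs.
    split; (apply ex_series_leR with (fun n => Cmod (a n) ^ 2); [|now exists s]);
      intros n; rewrite Cmod_sqr; apply Rabs_le; nra.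
  - intros [H1 H2]. destruct (ex_series_plus _ _ H1 H2) as [s Hs].
    exists s. apply is_series_Reals. apply is_series_ext with (2 := Hs).
    intros n. cbv beta. rewrite Cmod_sqr. reflexivity.
Qed.

(** * Orthogonality to every [h k] *)

(** [H2_orth] brings its own coefficient sequences; uniqueness identifies them with [a] and
    [hcoef k], whose square-summability is thereby obtained too. *)
Lemma orthogonal_h_series (f : Cx -> Cx) (a : nat -> Cx) (k : nat) :
  (1 <= k)%nat -> taylor_on_D a f -> H2_orth f (h k) ->
  ex_series (fun n => hcoef k n ^ 2) /\
  is_series (fun n => re (a n) * hcoef k n) 0 /\
  is_series (fun n => im (a n) * hcoef k n) 0.
Proof.
  intros Hk Ha (a' & b & _ & Hb2 & Ha' & Hb & H1 & H2).
  assert (Eb := taylor_h k b Hk Hb). assert (Ea := taylor_unique a' a f Ha' Ha).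
  split; [|split].
  - apply l2_re_im in Hb2. destruct Hb2 as [Hb2 _].
    apply ex_series_ext with (2 := Hb2). intros n. now rewrite Eb.
  - apply is_lim_seq_Reals, is_series_partial_sums in H1.
    apply is_series_ext with (2 := H1). intros n. rewrite Eb, Ea; simpl.
    match goal with |- ?a = ?b => change (a = b :> R) end. ring.
  - apply is_lim_seq_Reals, is_series_partial_sums in H2.
    apply is_series_ext with (2 := H2). intros n. rewrite Eb, Ea; simpl.
    match goal with |- ?a = ?b => change (a = b :> R) end. ring.
Qed.

(** The common end of both halves of the theorem: the relations between [a] and [g] express
    [f = c + (z - 1) g] on coefficients. *)
Lemma orthogonal_eq0 (f : Cx -> Cx) (a g : nat -> Cx) (c : Cx) :
  taylor_on_D a f -> l2 g ->
  a 0%nat = Csub c (g 0%nat) -> (forall n, a (S n) = Csub (g n) (g (S n))) ->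
  (forall k, (2 <= k)%nat -> H2_orth f (h k)) ->
  forall z, inD z -> f z = C0.
Proof.
  intros Ha Hg Ha0 HaS H z Hz.
  apply l2_re_im in Hg. destruct Hg as [Hg1 Hg2].
  assert (HS : forall k n, (2 <= k)%nat -> hcoef k (S n) - hcoef k n
     = (1 - (if dvdb k (S n) then INR k else 0)) / INR (S n)).
  { intros k n _. simpl hcoef. unfold hincr. ring. }
  assert (Hre : forall n, re (a n) = 0).
  { apply (orthogonal_coefficients_eq0 (fun n => re (g n)) (fun n => re (a n)) (re c) hcoef);
      trivial.
    - now rewrite Ha0.
    - intros n. now rewrite HaS.
    - intros k Hk. apply (orthogonal_h_series f a k); trivial; [lia|now apply H].
    - intros k Hk. apply (orthogonal_h_series f a k); trivial; [lia|now apply H]. }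
  assert (Him : forall n, im (a n) = 0).
  { apply (orthogonal_coefficients_eq0 (fun n => im (g n)) (fun n => im (a n)) (im c) hcoef);
      trivial.
    - now rewrite Ha0.
    - intros n. now rewrite HaS.
    - intros k Hk. apply (orthogonal_h_series f a k); trivial; [lia|now apply H].
    - intros k Hk. apply (orthogonal_h_series f a k); trivial; [lia|now apply H]. }
  destruct (Ha z Hz) as [H1 H2].
  assert (Z : forall u : nat -> R, (forall n, u n = 0) -> Un_cv (sum_f_R0 u) 0).
  { intros u Hu. apply is_lim_seq_Reals.
    apply (is_lim_seq_ext (fun _ => 0)); [|apply is_lim_seq_const].
    intros N. symmetry. apply sum_eq_R0. trivial. }
  apply Cx_eq.
  - apply UL_sequence with (1 := H1). apply Z. intros n. simpl. rewrite Hre, Him. ring.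
  - apply UL_sequence with (1 := H2). apply Z. intros n. simpl. rewrite Hre, Him. ring.
Qed.

Lemma D_delta1_orthogonal_eq0 (f : Cx -> Cx) : in_D_delta1 f ->
  (forall k, (2 <= k)%nat -> H2_orth f (h k)) -> forall z, inD z -> f z = C0.
Proof.
  intros (c & g & (gam & Hgam & Hg) & Hf) H.
  (* Orthogonality to [h 2] supplies a Taylor expansion of [f]. *)
  destruct (H 2%nat (le_n 2)) as (a & _ & _ & _ & Ha & _).
  (* Comparison of coefficients in [s = w + (x - 1) t], used once for the real and once for the
     imaginary parts. *)
  assert (E : forall (u v : nat -> R) (w : R) (s t : R -> R),
    (forall x, Rabs x < 1 -> is_series (fun n => u n * x ^ n) (s x)) ->
    (forall x, Rabs x < 1 -> is_series (fun n => v n * x ^ n) (t x)) ->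
    (forall x, Rabs x < 1 -> s x = w + (x - 1) * t x) ->
    forall n, u n = match n with O => w - v O | S m => v m - v (S m) end).
  { intros u v w s t Hu Hv Hst. apply power_series_unique with (1 := Hu).
    intros x Hx. rewrite (Hst x Hx). apply is_series_partial_sums.
    assert (Hd := is_series_backward_diff v x (t x) (Hv x Hx)).
    apply is_series_partial_sums in Hd.
    replace (w + (x - 1) * t x) with (w - (1 - x) * t x) by ring.
    apply (is_lim_seq_minus' _ _ _ _ (is_lim_seq_const w)) in Hd.
    apply is_lim_seq_ext with (2 := Hd).
    intros N. simpl. induction N as [|N IH].
    - simpl. ring.
    - rewrite 2!tech5, <- IH. unfold backward_diff. ring. }
  assert (HfR : forall x, Rabs x < 1 -> f (RtoC x) =
     Cadd c (Cmul (Csub (RtoC x) C1) (g (RtoC x)))).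
  { intros x Hx. apply Hf. unfold inD. now rewrite Cmod_RtoC. }
  assert (Ere : forall n, re (a n) = match n with O => re c - re (gam O)
     | S m => re (gam m) - re (gam (S m)) end).
  { apply (E (fun n => re (a n)) (fun n => re (gam n)) (re c)
      (fun x => re (f (RtoC x))) (fun x => re (g (RtoC x)))).
    - intros x Hx. now apply taylor_RtoC.
    - intros x Hx. now apply taylor_RtoC.
    - intros x Hx. rewrite HfR by trivial. simpl. ring. }
  assert (Eim : forall n, im (a n) = match n with O => im c - im (gam O)
     | S m => im (gam m) - im (gam (S m)) end).
  { apply (E (fun n => im (a n)) (fun n => im (gam n)) (im c)
      (fun x => im (f (RtoC x))) (fun x => im (g (RtoC x)))).
    - intros x Hx. now apply taylor_RtoC.
    - intros x Hx. now apply taylor_RtoC.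
    - intros x Hx. rewrite HfR by trivial. simpl. ring. }
  apply (orthogonal_eq0 f a gam c); trivial.
  - apply Cx_eq; [apply (Ere 0%nat)|apply (Eim 0%nat)].
  - intros n. apply Cx_eq; [apply (Ere (S n))|apply (Eim (S n))].
Qed.

(** * Parseval's identity at roots of unity *)

Lemma Cx_ring_theory : ring_theory C0 Defs.C1 Cadd Cmul Csub Copp (@eq Cx).
Proof. constructor; intros; apply Cx_eq; simpl; ring. Qed.
Add Ring Cx_ring : Cx_ring_theory.

(** The squared modulus is polynomial in the two parts, which keeps square roots out of the
    estimates. *)
Definition norm2 (z : Cx) : R := re z ^ 2 + im z ^ 2.

Lemma norm2_ge0 (z : Cx) : 0 <= norm2 z.
Proof. unfold norm2. nra. Qed.

Lemma norm2_mul (z w : Cx) : norm2 (Cmul z w) = norm2 z * norm2 w.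
Proof. unfold norm2; simpl. ring. Qed.

Lemma norm2_add_le (z w : Cx) : norm2 (Cadd z w) <= 2 * norm2 z + 2 * norm2 w.
Proof.
  assert (P := pow2_ge_0 (re z - re w)). assert (Q := pow2_ge_0 (im z - im w)).
  unfold norm2; simpl in *. lra.
Qed.

Fixpoint peval (u : nat -> Cx) (z : Cx) (N : nat) : Cx :=
  match N with
  | O => u O
  | S M => Cadd (peval u z M) (Cmul (u (S M)) (Cpow z (S M)))
  end.

Lemma peval_re_im (u : nat -> Cx) (z : Cx) (N : nat) :
  re (peval u z N) = sum_f_R0 (fun n => re (Cmul (u n) (Cpow z n))) N /\
  im (peval u z N) = sum_f_R0 (fun n => im (Cmul (u n) (Cpow z n))) N.
Proof.
  induction N as [|N [IH1 IH2]].
  - simpl. split; ring.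
  - rewrite 2!tech5, <- IH1, <- IH2. split; reflexivity.
Qed.

Definition circle_pt (r t : R) : Cx := mkC (r * cos t) (r * sin t).

Lemma norm2_circle_pt (r t : R) : norm2 (circle_pt r t) = r ^ 2.
Proof.
  unfold norm2, circle_pt; simpl. assert (H := sin2_cos2 t). unfold Rsqr in H.
  transitivity (r * r * (sin t * sin t + cos t * cos t)); [ring|rewrite H; ring].
Qed.

Lemma Cpow_circle_pt (r t : R) (n : nat) :
  Cpow (circle_pt r t) n = circle_pt (r ^ n) (INR n * t).
Proof.
  induction n as [|n IH].
  - apply Cx_eq; simpl; rewrite Rmult_0_l, ?cos_0, ?sin_0; ring.
  - change (Cpow (circle_pt r t) (S n)) with (Cmul (circle_pt r t) (Cpow (circle_pt r t) n)).
    rewrite IH, S_INR. replace ((INR n + 1) * t) with (t + INR n * t) by ring.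
    apply Cx_eq; simpl; rewrite ?cos_plus, ?sin_plus; ring.
Qed.

Lemma roots_of_unity_sum (m d : nat) : (0 < d <= m)%nat ->
  let t := 2 * PI * INR d / INR (S m) in
  sum_f_R0 (fun j => cos (INR j * t)) m = 0 /\
  sum_f_R0 (fun j => sin (INR j * t)) m = 0.
Proof.
  intros Hd t.
  assert (HM : 0 < INR (S m)) by (apply (lt_INR 0); lia).
  assert (Hd0 : 0 < INR d) by (apply (lt_INR 0); lia).
  assert (HdM : INR d < INR (S m)) by (apply lt_INR; lia).
  assert (HPI := PI_RGT_0).
  assert (Hs : 0 < sin (t / 2)).
  { replace (t / 2) with (PI * (INR d / INR (S m))) by (unfold t; field; lra).
    assert (0 < INR d / INR (S m)) by now apply Rdiv_lt_0_compat.
    assert (INR d / INR (S m) < 1).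
    { apply Rmult_lt_reg_r with (INR (S m)); trivial. unfold Rdiv.
      rewrite Rmult_assoc, Rinv_l; lra. }
    apply sin_gt_0; nra. }
  (* Since [(m + 1) * t] is a multiple of [2 * PI], the two ends of the telescoped sums cancel. *)
  assert (Hend : INR m * t + t / 2 = - (t / 2) + 2 * INR d * PI).
  { unfold t. rewrite S_INR in *. field. lra. }
  (* telescoping after multiplication by [2 * sin (t / 2)] *)
  assert (C : forall N, 2 * sin (t / 2) * sum_f_R0 (fun j => cos (INR j * t)) N
     = sin (INR N * t + t / 2) + sin (t / 2)).
  { induction N as [|N IH].
    - simpl. rewrite Rmult_0_l, Rplus_0_l, cos_0. ring.
    - rewrite tech5, Rmult_plus_distr_l, IH.
      replace (INR N * t + t / 2) with (INR (S N) * t - t / 2) by (rewrite S_INR; field).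
      rewrite sin_minus, sin_plus. ring. }
  assert (S : forall N, 2 * sin (t / 2) * sum_f_R0 (fun j => sin (INR j * t)) N
     = cos (t / 2) - cos (INR N * t + t / 2)).
  { induction N as [|N IH].
    - simpl. rewrite Rmult_0_l, Rplus_0_l, sin_0. ring.
    - rewrite tech5, Rmult_plus_distr_l, IH.
      replace (INR N * t + t / 2) with (INR (S N) * t - t / 2) by (rewrite S_INR; field).
      rewrite cos_minus, cos_plus. ring. }
  specialize (C m). specialize (S m).
  rewrite Hend, sin_period, sin_neg in C. rewrite Hend, cos_period, cos_neg in S.
  split; apply Rmult_eq_reg_l with (2 * sin (t / 2)); lra.
Qed.

Definition node (m : nat) (r : R) (j : nat) : Cx :=
  circle_pt r (2 * PI * INR j / INR (S m)).

(** The exponents differ by [L - n] with [1 <= L - n <= m], never a multiple of the number [m + 1]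
    of nodes, so monomials of different degree are orthogonal on the nodes. *)
Lemma sum_cross_term (m : nat) (r : R) (u : nat -> Cx) (v : Cx) (N L : nat) :
  (N < L <= m)%nat ->
  sum_f_R0 (fun j => re (Cmul (peval u (node m r j) N)
    (Cconj (Cmul v (Cpow (node m r j) L))))) m = 0.
Proof.
  intros HL.
  assert (T : forall n (w : Cx), (n < L)%nat ->
    sum_f_R0 (fun j => re (Cmul (Cmul w (Cpow (node m r j) n))
      (Cconj (Cmul v (Cpow (node m r j) L))))) m = 0).
  { intros n w Hn.
    destruct (roots_of_unity_sum m (L - n) ltac:(lia)) as [Ec Es].
    set (p := Cmul w (Cconj v)).
    set (t := 2 * PI * INR (L - n) / INR (S m)) in *.
    transitivity (r ^ n * r ^ L * re p * sum_f_R0 (fun j => cos (INR j * t)) m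
      + r ^ n * r ^ L * im p * sum_f_R0 (fun j => sin (INR j * t)) m);
      [|rewrite Ec, Es; ring].
    rewrite 2!scal_sum, <- plus_sum. apply sum_eq. intros j _.
    unfold node. rewrite 2!Cpow_circle_pt.
    set (s := 2 * PI * INR j / INR (S m)).
    assert (HM : INR (S m) <> 0) by (apply not_0_INR; lia).
    assert (E : INR j * t = INR L * s - INR n * s).
    { unfold t, s. rewrite minus_INR by lia. field. trivial. }
    rewrite E, cos_minus, sin_minus. unfold p, circle_pt; simpl. ring. }
  revert HL. induction N as [|N IH]; intros HL.
  - rewrite <- (T 0%nat (u 0%nat)) by lia. apply sum_eq. intros j _.
    replace (Cmul (u 0%nat) (Cpow (node m r j) 0)) with (u 0%nat) by (simpl; ring).
    reflexivity.
  - assert (E := f_equal2 Rplus (IH ltac:(lia)) (T (S N) (u (S N)) ltac:(lia))).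
    rewrite Rplus_0_l, <- plus_sum in E. rewrite <- E.
    apply sum_eq. intros j _. simpl peval.
    generalize (Cconj (Cmul v (Cpow (node m r j) L))). intros q.
    simpl. ring.
Qed.

(** Induction on the degree: expanding the square of a sum leaves a cross term that vanishes. The
    condition [N <= m] excludes aliasing. *)
Lemma discrete_parseval (m : nat) (r : R) (u : nat -> Cx) (N : nat) : (N <= m)%nat ->
  sum_f_R0 (fun j => norm2 (peval u (node m r j) N)) m
  = INR (S m) * sum_f_R0 (fun n => norm2 (u n) * r ^ (2 * n)) N.
Proof.
  induction N as [|N IH]; intros HN.
  - simpl peval. rewrite sum_cte. simpl. ring.
  - rewrite tech5, Rmult_plus_distr_l, <- IH by lia.
    set (v := u (S N)).
    assert (X := sum_cross_term m r u v N (S N) ltac:(lia)).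
    transitivity (sum_f_R0 (fun j => norm2 (peval u (node m r j) N)) m
      + sum_f_R0 (fun j => re (Cmul (peval u (node m r j) N)
          (Cconj (Cmul v (Cpow (node m r j) (S N)))))) m * 2
      + sum_f_R0 (fun _ => norm2 v * r ^ (2 * S N)) m);
      [|rewrite X, sum_cte; ring].
    rewrite (Rmult_comm _ 2), scal_sum, <- 2!plus_sum. apply sum_eq. intros j _.
    assert (E : norm2 v * r ^ (2 * S N) = norm2 (Cmul v (Cpow (node m r j) (S N)))).
    { unfold node. rewrite norm2_mul, Cpow_circle_pt, norm2_circle_pt, <- pow_mult.
      f_equal. f_equal. lia. }
    rewrite E. simpl peval. fold v.
    change (Cmul (node m r j) (Cpow (node m r j) N)) with (Cpow (node m r j) (S N)).
    generalize (Cmul v (Cpow (node m r j) (S N))). intros q.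
    unfold norm2; simpl. ring.
Qed.

(** These are the terms of the differentiated geometric series, convergent inside the unit disk. *)
Lemma lim_n_pow (r : R) : 0 <= r < 1 -> is_lim_seq (fun n => INR (S n) * r ^ n) 0.
Proof.
  intros Hr. apply is_lim_seq_abs_0. apply ex_series_lim_0.
  apply (ex_series_ext (fun n => Rabs (PS_derive (fun _ => 1) n * r ^ n))).
  - intros n. unfold PS_derive. now rewrite Rmult_1_r.
  - apply CV_disk_inside. rewrite CV_radius_derive.
    apply Rbar_lt_le_trans with (Finite 1).
    + simpl. rewrite Rabs_right; lra.
    + apply (CV_radius_ge_bounded (fun _ => 1) 1 1). intros n.
      rewrite pow1, Rmult_1_r, Rabs_R1. lra.
Qed.

Lemma geometric_tail (w : nat -> R) (C r l : R) : 0 <= r < 1 -> 0 <= C ->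
  (forall n, Rabs (w n) <= C * r ^ n) -> Un_cv (sum_f_R0 w) l ->
  forall N, Rabs (sum_f_R0 w N - l) <= C * r ^ N / (1 - r).
Proof.
  intros Hr HC Hw Hl N.
  assert (Hi : 0 < / (1 - r)) by (apply Rinv_0_lt_compat; lra).
  (* The exact finite geometric sum makes the induction close; it is weakened to a bound free of [k]
     before the limit. *)
  assert (H : forall k, Rabs (sum_f_R0 w (k + N) - sum_f_R0 w N)
     <= C * (r ^ N - r ^ (k + N)) / (1 - r)).
  { induction k as [|k IH].
    - simpl. rewrite 2!Rminus_diag, Rabs_R0, Rmult_0_r. unfold Rdiv. lra.
    - change (S k + N)%nat with (S (k + N)). rewrite tech5.
      replace (sum_f_R0 w (k + N) + w (S (k + N)) - sum_f_R0 w N)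
        with ((sum_f_R0 w (k + N) - sum_f_R0 w N) + w (S (k + N))) by ring.
      apply Rle_trans with (1 := Rabs_triang _ _).
      apply Rle_trans with (C * (r ^ N - r ^ (k + N)) / (1 - r) + C * r ^ (k + N)).
      + apply Rplus_le_compat; trivial. apply Rle_trans with (1 := Hw _).
        apply Rmult_le_compat_l; trivial. simpl.
        assert (0 <= r ^ (k + N)) by (apply pow_le; lra). nra.
      + simpl. right. field. lra. }
  assert (H' : forall k, Rabs (sum_f_R0 w (k + N) - sum_f_R0 w N) <= C * r ^ N / (1 - r)).
  { intros k. apply Rle_trans with (1 := H k). apply Rmult_le_compat_r; [lra|].
    assert (0 <= r ^ (k + N)) by (apply pow_le; lra). nra. }
  rewrite Rabs_minus_sym.
  apply (is_lim_seq_le (fun k => Rabs (sum_f_R0 w (k + N) - sum_f_R0 w N))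
    (fun _ => C * r ^ N / (1 - r)) (Rabs (l - sum_f_R0 w N)) (C * r ^ N / (1 - r)));
    trivial; [|apply is_lim_seq_const].
  apply (is_lim_seq_abs _ (Finite (l - sum_f_R0 w N))).
  apply is_lim_seq_minus'; [|apply is_lim_seq_const].
  apply (is_lim_seq_incr_n (sum_f_R0 w) N). now apply is_lim_seq_Reals.
Qed.

(** * Functions differentiable at 1 *)

Lemma bernoulli_le (t : R) (n : nat) : 0 <= t <= 1 -> 1 - INR n * t <= (1 - t) ^ n.
Proof.
  intros Ht. induction n as [|n IH]; [simpl; lra|].
  rewrite S_INR. simpl. assert (0 <= INR n) by apply pos_INR.
  assert (0 <= INR n * t) by nra. nra.
Qed.

Lemma ex_series_radial_bound (w : nat -> R) (B : R) :
  (forall n, 0 <= w n) ->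
  (forall r, 0 < r < 1 -> exists N0, forall N, (N0 <= N)%nat ->
    sum_f_R0 (fun n => w n * r ^ (2 * n)) N <= B) ->
  ex_series w.
Proof.
  intros Hw H. apply ex_series_bounded with (2 * B); trivial. intros N.
  (* By Bernoulli's inequality the radius [1 - t] satisfies [(1 - t) ^ (2 * n) >= 1 / 2] for all
     [n <= N], whence the bound [2 * B]. *)
  set (t := / (4 * INR (S N))).
  assert (HN : 1 <= INR (S N)) by (apply (le_INR 1); lia).
  assert (Ht : 0 < t) by (apply Rinv_0_lt_compat; lra).
  assert (Ht' : INR (S N) * t = / 4) by (unfold t; field; lra).
  destruct (H (1 - t) ltac:(nra)) as [N0 HN0].
  specialize (HN0 (N0 + N)%nat ltac:(lia)).
  assert (Hmono : forall k, sum_f_R0 (fun n => w n * (1 - t) ^ (2 * n)) N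
     <= sum_f_R0 (fun n => w n * (1 - t) ^ (2 * n)) (k + N)).
  { induction k as [|k IH]; [apply Rle_refl|].
    change (S k + N)%nat with (S (k + N)). rewrite tech5.
    assert (0 <= (1 - t) ^ (2 * S (k + N))) by (apply pow_le; nra).
    assert (P := Rmult_le_pos _ _ (Hw (S (k + N))) H0). lra. }
  apply Rle_trans with (2 * sum_f_R0 (fun n => w n * (1 - t) ^ (2 * n)) N);
    [|specialize (Hmono N0); lra].
  rewrite scal_sum. apply sum_Rle. intros n Hn.
  assert (Hb := bernoulli_le t (2 * n) ltac:(nra)). rewrite mult_INR in Hb.
  assert (INR n <= INR (S N)) by (apply le_INR; lia).
  assert (1 / 2 <= (1 - t) ^ (2 * n)) by (simpl in Hb |- *; nra).
  specialize (Hw n). nra.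
Qed.

Lemma Cderivable_at_bound (f : Cx -> Cx) (p : Cx) : Cderivable_at f p ->
  exists K d, 0 <= K /\ 0 < d /\ forall z, 0 < norm2 (Csub z p) < d ->
    norm2 (Csub (f z) (f p)) <= K * norm2 (Csub z p).
Proof.
  intros [l Hl]. destruct (Hl 1 Rlt_0_1) as [d [Hd H]].
  (* Within [d] of [p] the difference quotient is at distance less than 1 from [l], so its squared
     modulus is at most [2 + 2 * norm2 l]. *)
  exists (2 + 2 * norm2 l), (d ^ 2). assert (Pl := norm2_ge0 l).
  split; [lra|]. split; [nra|]. intros z Hz.
  set (w := Csub z p) in *.
  assert (Hw : 0 < Cmod w < d).
  { unfold Cmod. fold (norm2 w). split; [apply sqrt_lt_R0; lra|].
    rewrite <- (sqrt_pow2 d) by lra. apply sqrt_lt_1_alt. lra. }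
  specialize (H w Hw). replace (Cadd p w) with z in H by (unfold w; ring).
  set (q := Cdiv (Csub (f z) (f p)) w) in *.
  assert (E : Csub (f z) (f p) = Cmul w q).
  { unfold q, Cdiv. generalize (Csub (f z) (f p)). intros v.
    transitivity (Cmul v (Cmul w (Cinv w))); [|ring].
    replace (Cmul w (Cinv w)) with Defs.C1; [ring|].
    unfold norm2 in Hz. apply Cx_eq; simpl in *; field; lra. }
  rewrite E, norm2_mul, Rmult_comm. apply Rmult_le_compat_r; [lra|].
  replace q with (Cadd (Csub q l) l) by ring.
  apply Rle_trans with (1 := norm2_add_le _ _).
  assert (norm2 (Csub q l) <= 1); [|lra].
  change (Cmod (Csub q l)) with (sqrt (norm2 (Csub q l))) in H.
  rewrite <- (sqrt_sqrt (norm2 (Csub q l))) by apply norm2_ge0.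
  assert (P := sqrt_pos (norm2 (Csub q l))). nra.
Qed.

(** If [A] are the coefficients of [F], these are those of [F / (z - 1)], as [1 / (z - 1)] is minus
    the geometric series. *)
Fixpoint neg_sums (A : nat -> Cx) (n : nat) : Cx :=
  match n with
  | O => Copp (A O)
  | S m => Csub (neg_sums A m) (A (S m))
  end.

Lemma peval_neg_sums (A : nat -> Cx) (z : Cx) (N : nat) :
  Cmul (Csub z Defs.C1) (peval (neg_sums A) z N)
  = Cadd (peval A z N) (Cmul (neg_sums A N) (Cpow z (S N))).
Proof.
  induction N as [|N IH].
  - simpl. ring.
  - change (peval (neg_sums A) z (S N))
      with (Cadd (peval (neg_sums A) z N) (Cmul (neg_sums A (S N)) (Cpow z (S N)))).
    change (peval A z (S N)) with (Cadd (peval A z N) (Cmul (A (S N)) (Cpow z (S N)))).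
    transitivity (Cadd (Cmul (Csub z Defs.C1) (peval (neg_sums A) z N))
      (Cmul (Csub z Defs.C1) (Cmul (neg_sums A (S N)) (Cpow z (S N))))); [ring|].
    rewrite IH. change (Cpow z (S (S N))) with (Cmul z (Cpow z (S N))).
    change (neg_sums A (S N)) with (Csub (neg_sums A N) (A (S N))). ring.
Qed.

Lemma lim_0_sqr_small (s : nat -> R) (eps : R) : is_lim_seq s 0 -> 0 < eps ->
  exists N0, forall N, (N0 <= N)%nat -> s N ^ 2 <= eps.
Proof.
  intros Hs He.
  assert (H : is_lim_seq (fun n => s n * s n) (0 * 0)) by now apply is_lim_seq_mult'.
  rewrite Rmult_0_l in H. apply is_lim_seq_Reals in H.
  destruct (H eps He) as [N0 HN0]. exists N0. intros N HN.
  specialize (HN0 N HN). unfold Rdist in HN0. apply Rabs_def2 in HN0. nra.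
Qed.

Lemma norm2_Cpow (z : Cx) (r : R) (n : nat) : norm2 z = r ^ 2 ->
  norm2 (Cpow z n) = (r ^ n) ^ 2.
Proof.
  intros Hz. induction n as [|n IH]; [unfold norm2; simpl; ring|].
  simpl Cpow. rewrite norm2_mul, Hz, IH. simpl. ring.
Qed.

(** All terms on the circle are dominated by [sqrt C * r ^ n], so one [N0] serves the whole circle,
    as the sum over the nodes requires. *)
Lemma peval_remainder (A : nat -> Cx) (F : Cx -> Cx) (C r eps : R) :
  (forall n, norm2 (A n) <= C) -> taylor_on_D A F -> 0 < r < 1 -> 0 < eps ->
  exists N0, forall N z, (N0 <= N)%nat -> norm2 z = r ^ 2 ->
    norm2 (Csub (peval A z N) (F z)) <= eps.
Proof.
  intros HA HF Hr He.
  set (B := sqrt C).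
  assert (HB : 0 <= B) by apply sqrt_pos.
  assert (HC : 0 <= C) by (apply Rle_trans with (2 := HA 0%nat), norm2_ge0).
  destruct (lim_0_sqr_small (fun N => B * r ^ N / (1 - r)) (eps / 2)) as [N0 HN0].
  { apply (is_lim_seq_ext (fun N => B / (1 - r) * r ^ N)).
    - intros N. unfold Rdiv. ring.
    - replace (Finite 0) with (Rbar_mult (B / (1 - r)) 0) by (simpl; f_equal; ring).
      apply is_lim_seq_scal_l, is_lim_seq_geom. rewrite Rabs_right; lra. }
  { lra. }
  exists N0. intros N z HN Hz.
  assert (HzD : inD z).
  { unfold inD, Cmod. fold (norm2 z). rewrite Hz, sqrt_pow2; lra. }
  assert (T : forall n, Rabs (re (Cmul (A n) (Cpow z n))) <= B * r ^ n /\
                        Rabs (im (Cmul (A n) (Cpow z n))) <= B * r ^ n).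
  { intros n. assert (H : norm2 (Cmul (A n) (Cpow z n)) <= (B * r ^ n) ^ 2).
    { rewrite norm2_mul, (norm2_Cpow z r n Hz), Rpow_mult_distr.
      apply Rmult_le_compat_r; [apply pow2_ge_0|]. unfold B. rewrite pow2_sqrt; auto. }
    assert (P : 0 <= B * r ^ n) by (apply Rmult_le_pos; [trivial|apply pow_le; lra]).
    unfold norm2 in H.
    generalize dependent (re (Cmul (A n) (Cpow z n))).
    generalize dependent (im (Cmul (A n) (Cpow z n))).
    intros y x H. split; apply Rabs_le; nra. }
  destruct (HF z HzD) as [H1 H2]. destruct (peval_re_im A z N) as [E1 E2].
  assert (G1 := geometric_tail _ B r _ ltac:(lra) HB (fun n => proj1 (T n)) H1 N).
  assert (G2 := geometric_tail _ B r _ ltac:(lra) HB (fun n => proj2 (T n)) H2 N).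
  rewrite <- E1 in G1. rewrite <- E2 in G2.
  specialize (HN0 N HN). unfold norm2; simpl re; simpl im.
  apply pow_maj_Rabs with (n := 2%nat) in G1, G2.
  unfold Rminus in *. lra.
Qed.

(** Partial sums of a bounded sequence grow at most linearly, which [r ^ N] outweighs uniformly on
    the circle. *)
Lemma neg_sums_pow_small (A : nat -> Cx) (C r eps : R) :
  (forall n, norm2 (A n) <= C) -> 0 < r < 1 -> 0 < eps ->
  exists N0, forall N z, (N0 <= N)%nat -> norm2 z = r ^ 2 ->
    norm2 (Cmul (neg_sums A N) (Cpow z (S N))) <= eps.
Proof.
  intros HA Hr He.
  set (B := sqrt C).
  assert (HC : 0 <= C) by (apply Rle_trans with (2 := HA 0%nat), norm2_ge0).
  assert (HB : 0 <= B) by apply sqrt_pos.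
  assert (HBC : B ^ 2 = C) by (unfold B; rewrite pow2_sqrt; auto).
  assert (Hs : forall N, Rabs (re (neg_sums A N)) <= INR (S N) * B /\
                         Rabs (im (neg_sums A N)) <= INR (S N) * B).
  { assert (HAn : forall n, Rabs (re (A n)) <= B /\ Rabs (im (A n)) <= B).
    { intros n. specialize (HA n). unfold norm2 in HA. rewrite <- HBC in HA.
      split; apply Rabs_le; nra. }
    induction N as [|N [IH1 IH2]].
    - simpl. rewrite 2!Rabs_Ropp, Rmult_1_l. apply HAn.
    - rewrite S_INR. destruct (HAn (S N)) as [H1 H2]. simpl neg_sums. simpl re. simpl im.
      split; (apply Rle_trans with (1 := Rabs_triang _ _)); rewrite Rabs_Ropp; lra. }
  destruct (lim_0_sqr_small (fun N => B * (INR (S N) * r ^ N)) (eps / 2)) as [N0 HN0].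
  { replace (Finite 0) with (Rbar_mult B 0) by (simpl; f_equal; ring).
    apply is_lim_seq_scal_l, lim_n_pow. lra. }
  { lra. }
  exists N0. intros N z HN Hz. specialize (HN0 N HN).
  rewrite norm2_mul, (norm2_Cpow z r (S N) Hz).
  destruct (Hs N) as [H1 H2].
  assert (P : norm2 (neg_sums A N) <= 2 * (INR (S N) * B) ^ 2).
  { unfold norm2. apply pow_maj_Rabs with (n := 2%nat) in H1, H2. lra. }
  assert (Q : 0 <= (r ^ S N) ^ 2 <= (r ^ N) ^ 2).
  { split; [apply pow2_ge_0|]. simpl. assert (0 <= r ^ N) by (apply pow_le; lra).
    assert (0 <= r * r ^ N <= r ^ N) by nra. nra. }
  apply Rle_trans with (2 * (INR (S N) * B) ^ 2 * (r ^ N) ^ 2).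
  - apply Rmult_le_compat; try apply norm2_ge0; tauto.
  - apply Rle_trans with (2 * (B * (INR (S N) * r ^ N)) ^ 2); [|lra].
    right. ring.
Qed.

(* Near [1] the difference quotient is bounded because [F] is Lipschitz at [1];
   away from [1] it is dominated by [F] itself. *)
Lemma l2_neg_sums (A : nat -> Cx) (F : Cx -> Cx) (K d : R) :
  l2 A -> taylor_on_D A F -> 0 <= K -> 0 < d ->
  (forall z, inD z -> norm2 (Csub z Defs.C1) < d ->
     norm2 (F z) <= K * norm2 (Csub z Defs.C1)) ->
  l2 (neg_sums A).
Proof.
  intros HA HF HK Hd Hloc.
  assert (HexA : ex_series (fun n => norm2 (A n))).
  { apply l2_re_im in HA. exact (ex_series_plus _ _ (proj1 HA) (proj2 HA)). }
  assert (Hpart : forall N, sum_f_R0 (fun n => norm2 (A n)) N <= Series (fun n => norm2 (A n))).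
  { intros N. rewrite (Series_incr_n _ (S N)); [|lia|trivial]. simpl pred.
    assert (0 <= Series (fun k => norm2 (A (S N + k)%nat))); [|lra].
    apply Series_ge0.
    - intros k. apply norm2_ge0.
    - now apply (ex_series_incr_n (fun n => norm2 (A n)) (S N)). }
  set (SA := Series (fun n => norm2 (A n))) in *.
  assert (HAb : forall n, norm2 (A n) <= SA).
  { intros n. apply Rle_trans with (2 := Hpart n). destruct n as [|n]; [apply Rle_refl|].
    rewrite tech5. assert (P := cond_pos_sum (fun n => norm2 (A n)) n (fun n => norm2_ge0 (A n))).
    lra. }
  (* [4 * K + 4] is the bound near 1; away from 1 the bound is [2 / d * norm2 P + 2 / d]. *)
  set (B1 := 4 * K + 4 + 2 / d). set (B2 := 2 / d).
  assert (Hid : 0 < / d) by now apply Rinv_0_lt_compat.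
  assert (Hex : ex_series (fun n => norm2 (neg_sums A n))).
  { apply ex_series_radial_bound with (B1 + B2 * SA); [intros; apply norm2_ge0|].
    intros r Hr.
    assert (Hr2 : 0 < (1 - r) ^ 2 <= 1) by nra.
    (* Errors of order [(1 - r) ^ 2] stay bounded after division by [norm2 w], which is at least
       [(1 - r) ^ 2] on the circle. *)
    destruct (peval_remainder A F SA r ((1 - r) ^ 2 / 2) HAb HF Hr ltac:(lra)) as [N1 HN1].
    destruct (neg_sums_pow_small A SA r ((1 - r) ^ 2 / 2) HAb Hr ltac:(lra)) as [N2 HN2].
    exists (N1 + N2)%nat. intros N HN.
    assert (Hpt : forall z, norm2 z = r ^ 2 ->
      norm2 (peval (neg_sums A) z N) <= B1 + B2 * norm2 (peval A z N)).
    { intros z Hz. specialize (HN1 N z ltac:(lia) Hz). specialize (HN2 N z ltac:(lia) Hz).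
      set (G := peval (neg_sums A) z N). set (P := peval A z N) in *.
      set (e := Cmul (neg_sums A N) (Cpow z (S N))) in *.
      set (w := Csub z Defs.C1) in *.
      assert (Eq : norm2 w * norm2 G = norm2 (Cadd P e)).
      { unfold w, G, P, e. now rewrite <- norm2_mul, peval_neg_sums. }
      assert (Hw : (1 - r) ^ 2 <= norm2 w).
      { unfold w, norm2 in *; simpl in *. assert (re z <= r) by nra. nra. }
      assert (PG := norm2_ge0 G). assert (PP := norm2_ge0 P).
      destruct (Rlt_le_dec (norm2 w) d) as [Hnear|Hfar].
      - assert (HzD : inD z).
        { unfold inD, Cmod. fold (norm2 z). rewrite Hz, sqrt_pow2; lra. }
        assert (L := Hloc z HzD Hnear). fold w in L.
        assert (H : norm2 (Cadd P e) <= 4 * norm2 (F z) + 4 * (1 - r) ^ 2).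
        { replace (Cadd P e) with (Cadd (Cadd (F z) (Csub P (F z))) e) by ring.
          assert (I1 := norm2_add_le (Cadd (F z) (Csub P (F z))) e).
          assert (I2 := norm2_add_le (F z) (Csub P (F z))). lra. }
        assert (H2 : norm2 w * norm2 G <= norm2 w * (4 * K + 4)) by (rewrite Eq; lra).
        apply Rmult_le_reg_l in H2; [|lra].
        assert (0 <= B2 * norm2 P) by (unfold B2; apply Rmult_le_pos; lra).
        unfold B1. lra.
      - assert (I := norm2_add_le P e).
        assert (H2 : d * norm2 G <= d * (2 / d * norm2 P + 2 / d)).
        { apply Rle_trans with (norm2 w * norm2 G); [now apply Rmult_le_compat_r|].
          rewrite Eq. replace (d * (2 / d * norm2 P + 2 / d)) with (2 * norm2 P + 2) by (field; lra).
          lra. }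
        apply Rmult_le_reg_l in H2; trivial. unfold B1, B2. lra. }
    assert (HM : 0 < INR (S N)) by (apply (lt_INR 0); lia).
    (* Summing the pointwise bound over the [S N] nodes and applying Parseval on both sides yields
       the bound on coefficients. *)
    apply Rmult_le_reg_l with (INR (S N)); trivial.
    rewrite <- discrete_parseval by lia.
    apply Rle_trans with (sum_f_R0 (fun j => B1 + B2 * norm2 (peval A (node N r j) N)) N).
    { apply sum_Rle. intros j _. apply Hpt. apply norm2_circle_pt. }
    rewrite plus_sum, sum_cte.
    rewrite (sum_eq _ (fun j => norm2 (peval A (node N r j) N) * B2)) by (intros; ring).
    rewrite <- scal_sum, discrete_parseval by lia.
    rewrite Rmult_plus_distr_l, (Rmult_comm B1). apply Rplus_le_compat_l.
    replace (INR (S N) * (B2 * SA)) with (B2 * (INR (S N) * SA)) by ring.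
    apply Rmult_le_compat_l; [unfold B2; lra|].
    apply Rmult_le_compat_l; [lra|].
    apply Rle_trans with (2 := Hpart N). apply sum_Rle. intros n _.
    assert (r ^ (2 * n) <= 1).
    { rewrite <- (pow1 (2 * n)). apply pow_incr. lra. }
    assert (P := norm2_ge0 (A n)). nra. }
  apply l2_re_im. split.
  all: apply ex_series_leR with (2 := Hex); intros n; unfold norm2; apply Rabs_le; nra.
Qed.

Lemma derivable_at_1_orthogonal_eq0 (f : Cx -> Cx) : Cderivable_at f Defs.C1 ->
  (forall k, (2 <= k)%nat -> H2_orth f (h k)) -> forall z, inD z -> f z = C0.
Proof.
  intros Hder H.
  destruct (H 2%nat (le_n 2)) as (a & _ & Ha2 & _ & Ha & _).
  set (c := f Defs.C1).
  (* Coefficients of [f - f(1)], the function to be divided by [z - 1]. *)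
  set (A := fun n => match n with O => Csub (a O) c | S _ => a n end).
  assert (HA2 : l2 A).
  { apply l2_re_im in Ha2. destruct Ha2 as [H1 H2]. apply l2_re_im.
    split; apply ex_series_incr_1.
    - exact (proj1 (ex_series_incr_1 (fun n => re (a n) ^ 2)) H1).
    - exact (proj1 (ex_series_incr_1 (fun n => im (a n) ^ 2)) H2). }
  assert (HA : taylor_on_D A (fun z => Csub (f z) c)).
  { intros z Hz. destruct (Ha z Hz) as [H1 H2].
    apply is_lim_seq_Reals in H1, H2.
    assert (L1 := is_lim_seq_minus' _ _ _ _ H1 (is_lim_seq_const (re c))).
    assert (L2 := is_lim_seq_minus' _ _ _ _ H2 (is_lim_seq_const (im c))).
    split; apply is_lim_seq_Reals.
    - apply is_lim_seq_ext with (2 := L1). induction n as [|n IH]; [unfold A; simpl; ring|].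
      rewrite 2!tech5, <- IH. change (A (S n)) with (a (S n)). ring.
    - apply is_lim_seq_ext with (2 := L2). induction n as [|n IH]; [unfold A; simpl; ring|].
      rewrite 2!tech5, <- IH. change (A (S n)) with (a (S n)). ring. }
  destruct (Cderivable_at_bound f Defs.C1 Hder) as (K & d & HK & Hd & Hloc).
  apply (orthogonal_eq0 f a (neg_sums A) c); trivial.
  - apply l2_neg_sums with (fun z => Csub (f z) c) K d; trivial.
    intros z Hz Hzd. apply Hloc. split; [|exact Hzd].
    (* A point of the open disk differs from 1, as the local bound demands. *)
    unfold inD, Cmod in Hz. rewrite <- sqrt_1 in Hz. apply sqrt_lt_0_alt in Hz.
    unfold norm2; simpl in *. nra.
  - simpl. ring.
  - intros n. simpl. ring.
Qed.

Theorem mainTheorem12 :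
  (forall f : Cx -> Cx,
      in_D_delta1 f ->
      (forall k : nat, (2 <= k)%nat -> H2_orth f (h k)) ->
      forall z, inD z -> f z = C0) /\
  (forall f : Cx -> Cx,
      holo_near_closed_disk f ->
      (forall k : nat, (2 <= k)%nat -> H2_orth f (h k)) ->
      forall z, inD z -> f z = C0).
Proof.
  split; [exact D_delta1_orthogonal_eq0|].
  intros f (U & _ & HU & Hf). apply derivable_at_1_orthogonal_eq0.
  apply Hf, HU. change Defs.C1 with (RtoC 1). rewrite Cmod_RtoC, Rabs_R1. apply Rle_refl.
Qed.
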